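(* Let $X$ be a compact, first countable, Hausdorff space and let $(T,X)$ be a universally transitive semiflow such that $\mathrm{Aut}(T,X)$ is equicontinuous on $X$. Then $(T,X)$ is weakly almost periodic if and only if it is uniformly almost periodic.
   Context: $X$ carries its (symmetric) uniform structure $\mathscr{U}_X$; for $x\in X$ and $\varepsilon\in\mathscr{U}_X$ write $\varepsilon[x]=\{y\in X : (x,y)\in\varepsilon\}$. A semiflow $(T,X)$ consists of a topological semigroup $T$ with neutral element $e$ and a jointly continuous map $T\times X\to X$, $(t,x)\mapsto tx$, with $ex=x$ and $(ts)x=t(sx)$ for all $s,t\in T$, $x\in X$. $\mathrm{Aut}(T,X)$ is the group of all self-homeomorphisms $a$ of $X$ with $a(tx)=t(ax)$ for all $t\in T$, $x\in X$. $(T,X)$ is universally transitive if $\mathrm{Aut}(T,X)x=X$ for some (equivalently, all) $x\in X$. $\mathrm{Aut}(T,X)$ is equicontinuous if for every $\varepsilon\in\mathscr{U}_X$ there is $\delta\in\mathscr{U}_X$ such that $(x,y)\in\delta$ implies $(ax,ay)\in\varepsilon$ for all $a\in\mathrm{Aut}(T,X)$. $(T,X)$ is weakly almost periodic if for every $f\in C(X,\mathbb{R})$ the set $Tf=\{f_t : t\in T\}$, where $f_t(x)=f(tx)$, is relatively compact in $C(X,\mathbb{R})$ with the topology of pointwise convergence. A subset $A\subseteq T$ is syndetic if there is a compact $K\subseteq T$ with $Kt\cap A\neq\emptyset$ for every $t\in T$. $(T,X)$ is uniformly almost periodic if for every $\varepsilon\in\mathscr{U}_X$ there is a syndetic subset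 $A$ of $T$ such that $Ax\subseteq\varepsilon[x]$ for all $x\in X$. *)

(* Defs.v *)
From HB Require Import structures.
From mathcomp Require Import all_boot all_order all_algebra.
From mathcomp Require Import all_classical all_reals all_analysis.
Import numFieldNormedType.Exports.

Set Implicit Arguments.
Unset Strict Implicit.
Unset Printing Implicit Defensive.

Local Open Scope classical_set_scope.

(* Topological semigroups with a neutral element; no separation axiom on T. *)
HB.mixin Record isTopologicalMonoid M & Topological M & monoid.Monoid M := {
  mulg_continuous : continuous (fun p : M * M => (p.1 * p.2)%g) }.

#[short(type="topologicalMonoidType")]
HB.structure Definition TopologicalMonoid :=
  {M of Topological M & monoid.Monoid M & isTopologicalMonoid M}.

Record semiflow (T : topologicalMonoidType) (X : topologicalType) := Semiflow {
  act :> T -> X -> X;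
  act_continuous : continuous (fun p : T * X => act p.1 p.2);
  act1 : forall x, act 1%g x = x;
  actM : forall s t x, act (t * s)%g x = act t (act s x) }.

Definition first_countable (X : topologicalType) :=
  forall x : X, exists B : set (set X),
    [/\ countable B, B `<=` nbhs x &
        forall U, nbhs x U -> exists2 V, B V & V `<=` U].

Definition homeomorphism (X Y : topologicalType) (a : X -> Y) :=
  exists b : Y -> X, [/\ continuous a, continuous b, cancel a b & cancel b a].

Section Semiflow.
Variables (T : topologicalMonoidType) (X : uniformType).
Implicit Type phi : semiflow T X.

Definition Aut phi : set (X -> X) :=
  [set a | homeomorphism a /\ forall t x, a (phi t x) = phi t (a x)].

Definition universally_transitive phi :=
  exists x, [set a x | a in Aut phi] = [set: X].

(* The library's [equicontinuous] is the pointwise notion; here delta is chosen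
   uniformly in the point. *)
Definition unif_equicontinuous (F : set (X -> X)) :=
  forall eps : set (X * X), entourage eps ->
  exists2 delta : set (X * X), entourage delta &
    forall x y, delta (x, y) -> forall a, F a -> eps (a x, a y).

Lemma act_continuous_r phi t : continuous (phi t).
Proof.
move=> x; apply: (@continuous_comp _ _ _ (fun y => (t, y))
  (fun p : T * X => phi p.1 p.2)); last exact: act_continuous.
by apply: cvg_pair => /=; [exact: cvg_cst | exact: cvg_id].
Qed.

Lemma translate_continuous (Y : topologicalType) phi
  (f : continuousType X Y) t : continuous (f \o phi t).
Proof.
by move=> x; apply: continuous_comp; [exact: act_continuous_r | exact: cts_fun].
Qed.

Definition translate (Y : topologicalType) phi (f : continuousType X Y) (t : T)
  : continuousType X Y := mkcts (@translate_continuous Y phi f t).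

Section WeaklyAlmostPeriodic.
(* Gives [continuousType X R] the topology of pointwise convergence, so that
   [precompact], i.e. compactness of the closure, is taken inside C(X, R). *)
Import ArrowAsProduct.

Definition weakly_almost_periodic (R : realType) phi :=
  forall f : continuousType X R, precompact [set translate phi f t | t in [set: T]].
End WeaklyAlmostPeriodic.

Definition syndetic (A : set T) :=
  exists2 K : set T, compact K &
    forall t, [set (k * t)%g | k in K] `&` A !=set0.

Definition uniformly_almost_periodic phi :=
  forall eps : set (X * X), entourage eps ->
  exists2 A : set T, syndetic A &
    forall x, [set phi t x | t in A] `<=` xsection eps x.

End Semiflow.

(* Main.v *)
(* Both properties hold outright.  An automorphism commutes with the action, so
   what an element of T does at one point determines, by transitivity and
   equicontinuity of the automorphisms, what it does everywhere.  This makes T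
   equicontinuous, and weak almost periodicity follows by Arzela-Ascoli.  It
   also makes every orbit closure minimal, since its points are images a x of x
   and a is recurrent at x; hence the return times of x to a neighbourhood are
   syndetic, and at these times all points of X are nearly returned. *)
Require Import Defs.
From mathcomp Require Import all_boot all_order all_algebra.
From mathcomp Require Import all_classical all_reals all_analysis.
Import numFieldNormedType.Exports.

Local Open Scope classical_set_scope.

Lemma entourage_sym_split (X : uniformType) (E : set (X * X)) :
  entourage E -> exists D : set (X * X), [/\ entourage D,
    forall x y, D (x, y) -> D (y, x) &
    forall x y z, D (x, y) -> D (y, z) -> E (x, z)].
Proof.
move=> /entourage_split_ex[B entB BE]; exists (B `&` B^-1)%relation; split.
- exact: entourage_invI.
- by move=> x y [].
- by move=> x y z [Bxy _] [Byz _]; apply: BE; exists y.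
Qed.

Lemma compact_unif_continuous (X Y : uniformType) (f : X -> Y) :
  compact [set: X] -> continuous f -> unif_continuous f.
Proof.
move=> /compact_near_coveringP cov fc E entE.
(* [F] expresses that a property holds for all small enough entourages, so the covering form of
   compactness turns a choice at each point into one uniform entourage. *)
pose F := filter_from (@entourage X) (fun D => [set D' | D' `<=` D]).
have FF : Filter F.
  apply: filter_from_filter; first by exists setT; exact: entourageT.
  move=> C D entC entD; exists (C `&` D); first exact: filterI.
  by move=> D' CD; split=> p /CD[].
have [x _|D entD /(_ D (fun _ => id)) DE] := cov _ F
    (fun D x => forall y, D (x, y) -> E (f x, f y)) FF; last first.
  by apply: filterS entD => -[x y] /DE; exact.
have [B [entB Bsym BE]] := entourage_sym_split _ _ entE.
have /nbhsP[D entD DB] : nbhs x [set y | B (f x, f y)].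
  exact: (cvg_entourage (fc x) entB).
have [C [entC _ CD]] := entourage_sym_split _ _ entD.
exists (xsection D x `&` xsection C x, [set D' | D' `<=` C]).
  by split; [exact: filterI (nbhs_entourage _ _) (nbhs_entourage _ _)|exists C].
move=> [y D'] [/= [/DB Bxy /xsectionP Cxy] D'C] z /D'C Cyz.
apply: BE (Bsym _ _ Bxy) _; apply: DB; apply/xsectionP.
exact: CD Cxy Cyz.
Qed.

(** Transfers compactness from the space of all functions to $C(X,\mathbb{R})$: a cluster point of
    the image filter lies in [K], hence lifts along [f]. *)
Lemma compact_initial_topology (S : choiceType) (Z : topologicalType)
    (f : S -> Z) (K : set Z) : compact K -> K `<=` range f ->
  compact (f @^-1` K : set (initial_topology f)).
Proof.
move=> cK Kf F PF FK.
have [z [Kz clz]] := cK (f @ F) _ FK.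
have [s _ fs] := Kf z Kz; exists s; split; first by rewrite /preimage/= fs.
move=> A U FA [_ [[B Bop <-] Bfs BU]].
have FfA : (f @ F) (f @` A) by apply: (@filterS _ F _ A) => // a Aa; exists a.
have Bz : nbhs z B by rewrite -fs; exact: open_nbhs_nbhs.
by have [_ [[a Aa <-] Bfa]] := clz _ _ FfA Bz; exists a; split=> //; exact: BU.
Qed.

Lemma iter_can (S : Type) (f g : S -> S) n :
  cancel f g -> cancel (iter n f) (iter n g).
Proof. by move=> fK; elim: n => [//|n IH] x; rewrite iterSr iterS fK IH. Qed.

Section Automorphisms.
Variables (T : topologicalMonoidType) (X : uniformType) (phi : semiflow T X).

Local Notation orbit_closure x := (closure [set phi t x | t in [set: T]]).

Lemma Aut_iter a n : Aut phi a -> Aut phi (iter n a).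
Proof.
move=> [[b [ca cb ab ba]] aE]; split.
  exists (iter n b); split.
  - elim: n => [|n IH] x; first exact: cvg_id.
    exact: continuous_comp (IH x) (ca _).
  - elim: n => [|n IH] x; first exact: cvg_id.
    exact: continuous_comp (IH x) (cb _).
  - exact: iter_can.
  - exact: iter_can.
by move=> t x; elim: n => //= n ->; rewrite aE.
Qed.

Lemma Aut_inv a : Aut phi a ->
  exists b, [/\ Aut phi b, cancel a b & cancel b a].
Proof.
move=> [[b [ca cb ab ba]] aE]; exists b; split => //; split; first by exists a.
by move=> t x; rewrite -{1}(ba x) -aE ab.
Qed.

Lemma Aut_comp a b : Aut phi a -> Aut phi b -> Aut phi (a \o b).
Proof.
move=> [[a' [ca ca' aK a'K]] aE] [[b' [cb cb' bK b'K]] bE]; split.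
  exists (b' \o a'); split.
  - by move=> x; exact: continuous_comp (cb x) (ca _).
  - by move=> x; exact: continuous_comp (ca' x) (cb' _).
  - exact: can_comp.
  - exact: can_comp.
by move=> t x /=; rewrite bE aE.
Qed.

Lemma Aut_transitive : universally_transitive phi ->
  forall x y, exists2 a, Aut phi a & a x = y.
Proof.
move=> [z zX] x y.
have [a Aa ax] : [set a z | a in Aut phi] x by rewrite zX.
have [b Ab bz] : [set a z | a in Aut phi] y by rewrite zX.
have [a' [Aa' aK _]] := Aut_inv _ Aa.
by exists (b \o a'); [exact: Aut_comp | rewrite /= -ax aK].
Qed.

Lemma orbit_closure_refl x : orbit_closure x x.
Proof. by apply: subset_closure; exists 1%g => //; rewrite act1. Qed.

Lemma orbit_closure_act t x y : orbit_closure x y -> orbit_closure x (phi t y).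
Proof.
move=> xy U /(@act_continuous_r _ _ phi t y) /xy[_ [[s _ <-] Us]].
by exists (phi (t * s)%g x); split; [exists (t * s)%g | rewrite actM].
Qed.

(** As $a(sx) = s(ax)$, the map [a] sends the orbit of [x] into its closure, and continuity extends
    this to limits. It keeps all iterates $a^n x$ in that closure. *)
Lemma orbit_closure_Aut a x y : Aut phi a -> orbit_closure x (a x) ->
  orbit_closure x y -> orbit_closure x (a y).
Proof.
move=> [[b [ca _ _ _]] aE] xax xy.
rewrite (closure_id (orbit_closure x)).1; last exact: closed_closure.
move=> U /(ca y) /xy[_ [[s _ <-] Us]]; exists (a (phi s x)); split => //.
by rewrite aE; exact: orbit_closure_act.
Qed.

Hypotheses (compactX : compact [set: X])
  (phi_trans : universally_transitive phi) (Aut_equi : unif_equicontinuous (Aut phi)).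

Lemma orbit_closure_compact x : compact (orbit_closure x).
Proof. by apply: subclosed_compact compactX _ => //; exact: closed_closure. Qed.

(* For [y = a x] the automorphism [a] moves [s x] to [s y], which is close to
   [s x]; by equicontinuity and compactness [a] is then uniformly close to the
   identity on the orbit closure of [x]. *)
Lemma semiflow_equicontinuous x (E : set (X * X)) : entourage E ->
  \forall y \near x, forall t, E (phi t x, phi t y).
Proof.
move=> entE.
suff H : \forall y \near x, orbit_closure x `<=`
    [set z | forall a, Aut phi a -> a x = y -> E (z, a z)].
  apply: filterS H => y H t.
  have [a Aa ay] := Aut_transitive phi_trans x y.
  rewrite -ay -(Aa.2 t x); apply: H => //.
  by apply: subset_closure; exists t.
have /compact_near_coveringP cov := orbit_closure_compact x.
apply: (cov _ (nbhs x)
  (fun y z => forall a, Aut phi a -> a x = y -> E (z, a z))) => z xz.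
have [D1 [entD1 D1sym D1E]] := entourage_sym_split _ _ entE.
have [D2 [entD2 D2sym D2D1]] := entourage_sym_split _ _ entD1.
have [D3 entD3 D3D2] := Aut_equi _ entD2.
have [D4 [entD4 D4sym D4D3]] :=
  entourage_sym_split _ _ (filterI entD3 entD2).
(* [s] depends on [z] alone, so a single continuous map constrains [y]. The chain is then $z' \sim
   sx \sim sy = a(sx) \sim az'$. *)
have [_ [[s _ <-] /xsectionP zs]] := xz _ (nbhs_entourage z entD4).
have sD2 : \forall y \near x, D2 (phi s x, phi s y).
  exact: (cvg_entourage (@act_continuous_r _ _ phi s x) entD2).
exists (xsection D4 z, [set y | D2 (phi s x, phi s y)]).
  by split=> //; exact: nbhs_entourage.
move=> [z' y] [/= /xsectionP zz' sy] a Aa axy.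
have [D3zs D2zs] := D4D3 _ _ _ (D4sym _ _ zz') zs.
apply: (D1E _ (phi s y)); first exact: D2D1 D2zs sy.
apply: (D2D1 _ (a (phi s x))).
  by rewrite Aa.2 axy; exact: entourage_refl.
by apply: D2sym; exact: D3D2.
Qed.

(* Write [y = a x].  As [a ^ n x] and [a ^ m x] are close for some [n < m],
   [a ^ (m - n - 1) x], which lies in the orbit closure of [x], is close to
   [a ^ -1 x]; apply [a]. *)
Lemma orbit_return x y (E : set (X * X)) : entourage E -> orbit_closure x y ->
  exists k, E (x, phi k y).
Proof.
move=> entE xy; have [a Aa ay] := Aut_transitive phi_trans x y.
have [b [Ab aK bK]] := Aut_inv _ Aa.
have [D1 entD1 D1E] := Aut_equi _ entE.
have [D2 [entD2 _ D2D1]] := entourage_sym_split _ _ entD1.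
have [D3 entD3 D3D2] := Aut_equi _ entD2.
have [D4 [entD4 D4sym D4D3]] := entourage_sym_split _ _ entD3.
have xa n : orbit_closure x (iter n a x).
  elim: n => [|n IH]; first exact: orbit_closure_refl.
  by apply: (orbit_closure_Aut a) IH => //; rewrite ay.
have [p [_ clp]] := compactX ((fun n => iter n a x) @ \oo) _ filterT.
have often N : exists2 n, (N <= n)%N & D4 (p, iter n a x).
  have [||_ [[n /= Nn <-] /xsectionP pn]] :=
    clp [set iter n a x | n in [set n | (N <= n)%N]] (xsection D4 p).
  - by exists N => // n /= Nn; exists n.
  - exact: nbhs_entourage.
  - by exists n.
have [n _ pn] := often 0; have [m nm pm] := often n.+1.
(* Applying [b] one time more than [n] turns $a^n x$ into $b x$ and $a^m x$ into $a^{m-n-1} x$;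
   equicontinuity makes [D3] independent of [n]. *)
have D2bx : D2 (b x, iter (m - n.+1) a x).
  have := D3D2 _ _ (D4D3 _ _ _ (D4sym _ _ pn) pm) _ (Aut_iter _ n.+1 Ab).
  rewrite iterS iter_can //.
  by rewrite -[in iter m](subnKC nm) iterD iter_can.
have [_ [[k _ <-] /xsectionP D2k]] :=
  xa (m - n.+1) _ (nbhs_entourage _ entD2).
exists k; have := D1E _ _ (D2D1 _ _ _ D2bx D2k) _ Aa.
by rewrite bK Aa.2 ay.
Qed.

Lemma transitive_uniformly_almost_periodic : uniformly_almost_periodic phi.
Proof.
move=> E entE; have [x _] := phi_trans.
have [D entD DE] := Aut_equi _ entE.
have [D' [entD' _ D'D]] := entourage_sym_split _ _ entD.
exists [set t | D (x, phi t x)]; last first.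
  move=> y _ [t Dt <-]; apply/xsectionP.
  have [a Aa <-] := Aut_transitive phi_trans x y.
  by rewrite -Aa.2; exact: DE.
(* [F] expresses that a property holds for all sets containing some finite one; the covering
   argument then gives a finite, hence compact, set of return times for the whole orbit closure. *)
pose F := filter_from finite_set (fun K : set T => [set K' | K `<=` K']).
have FF : Filter F.
  apply: filter_from_filter; first by exists set0.
  move=> K L fK fL; exists (K `|` L); first by rewrite finite_setU.
  by move=> M /= KLM; split=> t ?; apply: KLM; [left|right].
have /compact_near_coveringP cov := orbit_closure_compact x.
have [y xy|K finK Kcov] := cov _ F
    (fun K y => exists2 k, K k & D (x, phi k y)) FF.
  have [k D'k] := orbit_return _ _ _ entD' xy.
  exists ([set z | D' (phi k y, phi k z)], [set K : set T | [set k] `<=` K]).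
    split; first exact: (cvg_entourage (@act_continuous_r _ _ phi k y) entD').
    by exists [set k].
  by move=> [z K] [/= D'z kK]; exists k; [exact: kK | exact: D'D D'k D'z].
exists K; first exact: finite_compact.
move=> t; have [|k Kk Dk] := Kcov K (fun _ => id) (phi t x).
  by apply: subset_closure; exists t.
by exists (k * t)%g; split; [exists k | rewrite /= actM].
Qed.

Lemma transitive_weakly_almost_periodic (R : realType) :
  weakly_almost_periodic R phi.
Proof.
move=> f; rewrite precompactE.
pose W : set (X -> R) := [set f \o phi t | t in [set: T]].
have equiW : equicontinuous W id.
  move=> x E entE.
  have fE := compact_unif_continuous _ _ f compactX cts_fun _ entE.
  apply: filterS (semiflow_equicontinuous x _ fE) => y fE'.
  by move=> _ [t _ <-]; exact: fE'.
have cptW : compact (closure (W : set {ptws X -> R})).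
  rewrite -precompactE -[W]image_id.
  apply: pointwise_precompact_precompact; first exact: norm_hausdorff.
  (* The values at [x] of the translates lie in the compact set $f(X)$. *)
  move=> x; apply: (precompact_subset (B := f @` [set: X])).
    by move=> _ [_ [t _ <-] <-]; exists (phi t x).
  apply: compact_precompact; first exact: norm_hausdorff.
  by apply: continuous_compact compactX; apply: continuous_subspaceT cts_fun.
(* Pointwise limits of an equicontinuous family are continuous, so the closure in the product adds
   only members of $C(X,\mathbb{R})$. *)
have cW : closure (W : set {ptws X -> R}) `<=`
    range (id : continuousType X R -> {ptws X -> R}).
  move=> g Wg.
  have cg : continuous (g : X -> R).
    exact: (equicontinuous_continuous (equicontinuous_closure equiW) Wg).
  by exists (mkcts cg).
have := @compact_initial_topology (continuousType X R) _ _ _ cptW cW.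
(* It remains to see that the closure taken in $C(X,\mathbb{R})$ lies in the preimage of the one
   taken in the product. *)
move/subclosed_compact; apply; first exact: closed_closure.
move=> g clg U /(@initial_continuous (continuousType X R) _ _ g) /clg.
move=> [_ [[t _ <-] Ut]]; exists (f \o phi t); split => //.
by exists t.
Qed.

End Automorphisms.

Theorem theorem2p34 (R : realType) (T : topologicalMonoidType) (X : uniformType)
  (phi : semiflow T X) (compactX : compact [set: X])
  (hausdorffX : hausdorff_space X) (first_countableX : first_countable X)
  (phi_trans : universally_transitive phi)
  (Aut_equi : unif_equicontinuous (Aut phi)) :
  weakly_almost_periodic R phi <-> uniformly_almost_periodic phi.
Proof.
split=> _; first exact: transitive_uniformly_almost_periodic.
exact: transitive_weakly_almost_periodic.
Qed.
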